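(* Let $Q=[n]^{(\geq n/2)}$ with the partial order $<$ defined below. Then $(Q,<)$ is a graded poset whose levels are $[n]^{(k)}$ for $\lceil n/2\rceil\leq k\leq n$, and $(Q,<)$ is a normalized matching poset.
   Context: For $x\subseteq[n]$ and integers $1\le i\le j\le n$ let $c_x(i,j)=|x\cap[i,j]|-|[i,j]\setminus x|$, where $[i,j]=\{i,\dots,j\}$. The signature $sg(x)\in\{0,1,*\}^n$ is defined as follows: if $i\in x$ and there is $j$ with $i<j\leq n$ and $c_x(i,j)=0$, then $sg(x)_i=1$, otherwise ($i\in x$) $sg(x)_i=*$; if $i\notin x$ and there is $j$ with $1\leq j<i$ and $c_x(j,i)=0$, then $sg(x)_i=0$, otherwise ($i\notin x$) $sg(x)_i=*$. Let $x\sim y$ iff $sg(x)=sg(y)$; each equivalence class is a symmetric chain in $2^{[n]}$ (a chain $c_0\subset\cdots\subset c_k$ with $|c_i|=(n-k)/2+i$). For $x\in Q$, let $p(x)$ be the unique element of the $\sim$-class of $x$ with $|x|+|p(x)|=n$. For $x,y\in Q$ define $y<x$ iff $y\neq x$ and $p(x)\subseteq p(y)\subseteq y\subseteq x$. A graded poset is a normalized matching poset if for any two distinct levels $A_i,A_j$, the bipartite comparability graph $G$ between them is a normalized matching graph: $|X|/|A_i|\le|\Gamma(X)|/|A_j|$ for every $X\subseteq A_i$, $\Gamma(X)$ being the neighbourhood of $X$. *)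

(* Defs.v *)
From HB Require Import structures.
From mathcomp Require Import all_boot all_order all_algebra.
Set Implicit Arguments.
Unset Strict Implicit.
Unset Printing Implicit Defensive.
Import Order.TTheory GRing.Theory Num.Theory.

Section GradedPosets.
Context {d : Order.disp_t} {P : finPOrderType d}.

Definition minimal (x : P) : Prop := forall y : P, ~~ (y < x)%O.

Definition covers (y x : P) : Prop :=
  (x < y)%O /\ forall z : P, ~~ ((x < z)%O && (z < y)%O).

(* [A lo, ..., A hi] are the levels of the graded poset [P]: a partition of [P]
   into nonempty sets, starting with the set of minimal elements, such that a
   cover of an element of [A i] lies in [A i.+1].  The levels of a graded poset
   are determined up to the shift [lo] of the index. *)
Definition graded (lo hi : nat) (A : nat -> {set P}) : Prop :=
  [/\ forall i, lo <= i <= hi -> A i != set0,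
      forall x : P, exists! i, lo <= i <= hi /\ x \in A i,
      forall x : P, x \in A lo <-> minimal x
    & forall (x y : P) i j, lo <= i <= hi -> lo <= j <= hi ->
        x \in A i -> y \in A j -> covers y x -> j = i.+1].

End GradedPosets.

Definition nbhd {T : finType} (E : rel T) (B X : {set T}) : {set T} :=
  [set y in B | [exists x in X, E x y]].

Definition normalized_matching_graph {T : finType} (E : rel T) (A B : {set T})
    : Prop :=
  forall X : {set T}, X \subset A ->
    (#|X|%:R / #|A|%:R <= #|nbhd E B X|%:R / #|B|%:R :> rat)%R.

Definition normalized_matching_poset {d : Order.disp_t} {P : finPOrderType d}
    (lo hi : nat) (A : nat -> {set P}) : Prop :=
  graded lo hi A /\
  forall i j, lo <= i <= hi -> lo <= j <= hi -> i != j ->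
    normalized_matching_graph (fun x y : P => (x >=< y)%O) (A i) (A j).

(* The ground set [n] = {1, ..., n} is represented by 'I_n = {0, ..., n - 1}. *)

Definition itv {n : nat} (i j : 'I_n) : {set 'I_n} := [set k : 'I_n | i <= k <= j].

Definition cdiff {n : nat} (x : {set 'I_n}) (i j : 'I_n) : int :=
  (#|x :&: itv i j|%:Z - #|itv i j :\: x|%:Z)%R.

(* The symbols 1, 0 and * are [Some true], [Some false] and [None]. *)
Definition sg {n : nat} (x : {set 'I_n}) : {ffun 'I_n -> option bool} :=
  [ffun i : 'I_n =>
    if i \in x then
      if [exists j : 'I_n, (i < j) && (cdiff x i j == 0%R)]
      then Some true else None
    else
      if [exists j : 'I_n, (j < i) && (cdiff x j i == 0%R)]
      then Some false else None].

(* The element of complementary size in the signature class of [x]; as the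
   class is a symmetric chain, it exists and is unique, so that the default
   value [x] is never used. *)
Definition partner {n : nat} (x : {set 'I_n}) : {set 'I_n} :=
  odflt x [pick y : {set 'I_n} | (sg y == sg x) && (#|x| + #|y| == n)].

Definition Q (n : nat) : Type := {x : {set 'I_n} | n <= #|x|.*2}.

HB.instance Definition _ (n : nat) := SubType.on (Q n).
HB.instance Definition _ (n : nat) := Finite.on (Q n).

Section QOrder.
Variable n : nat.
Implicit Types x y : Q n.

Definition Qlt y x : bool :=
  [&& y != x, partner (val x) \subset partner (val y),
      partner (val y) \subset val y & val y \subset val x].

Definition Qle y x : bool := (y == x) || Qlt y x.

Fact Qlt_def y x : Qlt y x = (x != y) && Qle y x.
Proof. by rewrite /Qle /Qlt eq_sym; case: eqP. Qed.

Fact Qle_refl : reflexive Qle.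
Proof. by move=> x; rewrite /Qle eqxx. Qed.

Fact Qle_anti : antisymmetric Qle.
Proof.
move=> x y /andP[/orP[/eqP //|/and4P[_ _ _ xy]] /orP[/eqP //|/and4P[_ _ _ yx]]].
by apply/val_inj/eqP; rewrite eqEsubset xy.
Qed.

Fact Qle_trans : transitive Qle.
Proof.
move=> y x z /orP[/eqP-> //|/and4P[_ pyx px xy]].
case/orP=> [/eqP<-|/and4P[_ pzy py yz]]; rewrite /Qle /Qlt; case: eqP => //= _.
  by rewrite pyx px.
by rewrite (subset_trans pzy pyx) px (subset_trans xy yz).
Qed.

End QOrder.

Fact Q_display : Order.disp_t. Proof. exact: Order.Disp tt tt. Qed.

HB.instance Definition _ (n : nat) :=
  Order.isPOrder.Build Q_display (Q n)
    (@Qlt_def n) (@Qle_refl n) (@Qle_anti n) (@Qle_trans n).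

Definition layer (n k : nat) : {set Q n} := [set x : Q n | #|val x| == k].

(* Main.v *)
Require Import Defs.
From HB Require Import structures.
From mathcomp Require Import all_boot all_order all_algebra.
From mathcomp Require Import zify.

(* Read the n-periodic repetition of x as a +1/-1 walk, a member of x being an up
   step.  When |x| >= n/2 the walk does not drift down, and p(x) is the set of
   the members of x after which the walk returns to its current height
   ([matched]), that is, the opening brackets matched in the cyclic bracketing
   of x.  To see that it has the signature of x and size n - |x|, compare with
   the future minimum m of the walk h: m increases by one exactly at the
   unmatched members of x, so m telescopes to their number 2|x| - n over a
   period, and the walk of p(x) is h - 2m up to a constant.

   Removing an unmatched member of x gives an element below x, and if x < y then
   some x + u with u in y \ x has u unmatched, so covers change the size by one.

   For the matching property of the adjacent levels k+1 and k, fix z and send x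
   with z not in p(x) to y = x - u, where u is the last minimum of the walk of x
   after time z.  This is injective, z is not in y, and y < x.  As each x has
   k+1 admissible z and each y has n-k, double counting with
   (k+1) C(n,k+1) = (n-k) C(n,k) gives the inequality downwards; complementation
   gives it upwards, and composition gives all pairs of levels. *)

Set Implicit Arguments.
Unset Strict Implicit.
Unset Printing Implicit Defensive.
Import Order.TTheory GRing.Theory Num.Theory.

(** * The periodic walk of a set and its unmatched times *)

Section Height.
Variable n : nat.
Implicit Types (x y : {set 'I_n}) (i j : 'I_n) (s t a b : nat).

(* [x] repeated [n]-periodically along [nat]. *)
Definition pmem x t : bool := [exists i in x, i == t %% n :> nat].

Definition height x t : int :=
  (\sum_(0 <= s < t) (if pmem x s then 1 else -1))%R.

Lemma pmem_ord x i : pmem x i = (i \in x).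
Proof.
apply/exists_inP/idP => [[j jx /eqP ji]|ix]; last by exists i; rewrite ?modn_small.
by rewrite modn_small // in ji; rewrite -(val_inj ji).
Qed.

Lemma pmem_mod x t : pmem x (t %% n) = pmem x t.
Proof. by rewrite /pmem modn_mod. Qed.

Lemma pmemD1 x i t : pmem (x :\ i) t = pmem x t && (i != t %% n :> nat).
Proof.
apply/exists_inP/andP => [[j /setD1P[ji jx] /eqP jt]|[/exists_inP[j jx /eqP jt] it]].
  by split; [apply/exists_inP; exists j; rewrite ?jt|rewrite -jt eq_sym].
by exists j; rewrite ?jt // !inE jx andbT; apply: contraNneq it => <-; rewrite jt.
Qed.

Lemma pmemU1 x i t : pmem (i |: x) t = pmem x t || (i == t %% n :> nat).
Proof.
apply/exists_inP/orP => [[j /setU1P[->|jx] jt]|[/exists_inP[j jx jt]|it]].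
- by right.
- by left; apply/exists_inP; exists j.
- by exists j => //; rewrite !inE jx orbT.
- by exists i => //; rewrite !inE eqxx.
Qed.

Lemma pmem_sub x y t : y \subset x -> pmem y t -> pmem x t.
Proof.
by move=> /subsetP yx /exists_inP[i /yx ix it]; apply/exists_inP; exists i.
Qed.

Lemma heightS x t :
  height x t.+1 = (height x t + (if pmem x t then 1 else -1))%R.
Proof. by rewrite /height big_nat_recr. Qed.

Lemma height0 x : height x 0 = 0%R.
Proof. by rewrite /height big_geq. Qed.

Lemma sum_steps x (P : pred 'I_n) :
  (\sum_(i | P i) (if i \in x then 1 else -1) =
    #|[set i in x | P i]|%:Z - #|[set i | P i & i \notin x]|%:Z :> int)%R.
Proof.
rewrite (bigID (mem x)) /= (eq_bigr (fun=> 1%R)); last by move=> i /andP[_ ->].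
rewrite [X in (_ + X)%R](eq_bigr (fun=> (-1)%R)); last first.
  by move=> i /andP[_ /negbTE->].
rewrite !sumr_const mulNrn !natz.
congr (Posz _ - Posz _)%R; apply: eq_card => i; rewrite !inE // unfold_in /=.
by rewrite andbC.
Qed.

Lemma height_total x : height x n = ((#|x|.*2)%:Z - n%:Z)%R.
Proof.
rewrite /height big_mkord (eq_bigr (fun i => if i \in x then 1 else -1)%R); last first.
  by move=> i _; rewrite pmem_ord.
rewrite sum_steps.
have -> : [set i in x | true] = x by apply/setP => i; rewrite !inE andbT.
have -> : [set i | true & i \notin x] = ~: x by apply/setP => i; rewrite !inE.
by have := cardsC x; rewrite card_ord; move: #|x| #|~: x| => a b; lia.
Qed.

Lemma heightDn x t : height x (t + n) = (height x t + height x n)%R.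
Proof.
elim: t => [|t IH]; first by rewrite height0 add0r.
rewrite addSn !heightS IH -(pmem_mod x (t + n)) modnDr pmem_mod; lia.
Qed.

Lemma heightDmul x t q : height x (t + q * n) = (height x t + height x n *+ q)%R.
Proof.
elim: q => [|q IH]; first by rewrite mul0n addn0 addr0.
by rewrite mulSnr addnA heightDn IH mulrSr addrA.
Qed.

Lemma height_mod x t :
  height x t = (height x (t %% n) + height x n *+ (t %/ n))%R.
Proof. by rewrite -heightDmul addnC -divn_eq. Qed.

Lemma height_agree x y a b : a <= b ->
  (forall s, a <= s < b -> pmem x s = pmem y s) ->
  (height x b - height x a = height y b - height y a)%R.
Proof.
elim: b => [|b IH]; first by rewrite leqn0 => /eqP-> _; rewrite !subrr.
rewrite leq_eqVlt => /predU1P[-> _|]; first by rewrite !subrr.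
rewrite ltnS => ab E; rewrite !heightS (E b) ?ab ?ltnSn //.
have : (height x b - height x a = height y b - height y a)%R.
  by apply: IH => // s sab; apply: E; lia.
by lia.
Qed.

Lemma height_mono x y a b : y \subset x -> a <= b ->
  (height y b - height y a <= height x b - height x a)%R.
Proof.
move=> yx; elim: b => [|b IH]; first by rewrite leqn0 => /eqP->; rewrite !subrr.
rewrite leq_eqVlt => /predU1P[->|]; first by rewrite !subrr.
rewrite ltnS => /IH {}IH; rewrite !heightS; have := @pmem_sub x y b yx.
by case: (pmem y b) => [/(_ isT)->|_]; [|case: ifP => _]; lia.
Qed.

Lemma cdiff_height x i j : i <= j ->
  cdiff x i j = (height x j.+1 - height x i)%R.
Proof.
move=> ij; rewrite /height (big_cat_nat _ (n := i)) //=; last exact: leqW.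
rewrite addrAC subrr add0r (big_nat_widenl _ 0) // (big_nat_widen _ _ n) //.
rewrite big_mkord (eq_bigr (fun i => if i \in x then 1 else -1)%R); last first.
  by move=> k _; rewrite pmem_ord.
rewrite sum_steps /cdiff; congr (Posz _ - Posz _)%R; apply: eq_card => k;
  rewrite !inE /= ltnS //.
by rewrite andbC.
Qed.

(** [s] runs over the whole infinite walk, not over one period, which makes the notion invariant
    under shifts of [t] by [n]. *)
Definition unmatched_at x t : Prop :=
  forall s, t < s -> (height x t < height x s)%R.

Lemma unmatched_at_mem x t : unmatched_at x t -> pmem x t.
Proof. by move=> /(_ t.+1 (ltnSn t)); rewrite heightS; case: ifP => // _; lia. Qed.

Lemma unmatched_at_mod x t : unmatched_at x (t %% n) <-> unmatched_at x t.
Proof.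
split=> U s ts.
  have := U (s - t %/ n * n); have := divn_eq t n; set q := t %/ n => tE.
  have -> : height x s = (height x (s - q * n) + height x n *+ q)%R.
    by rewrite -heightDmul subnK //; lia.
  rewrite (height_mod x t) -/q => H.
  by rewrite ltrD2r H //; lia.
have := U (s + t %/ n * n).
rewrite heightDmul (height_mod x t) ltrD2r; apply.
by rewrite [X in X < _](divn_eq t n); lia.
Qed.

(** Looking one period ahead keeps membership decidable; with nonnegative drift, later periods add
    no new return ([matchedP]). The window includes time i + n, so every member is matched when |x|
    = n/2. *)
Definition matched x : {set 'I_n} :=
  [set i in x | [exists k : 'I_n, (height x (i + k.+1) <= height x i)%R]].

Lemma matched_sub x : matched x \subset x.
Proof. by apply/subsetP => i; rewrite inE => /andP[]. Qed.

(** * Matched members and the future minimum, for nonnegative drift *)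

Section NonnegDrift.
Variable x : {set 'I_n}.
Hypothesis drift : (0 <= height x n)%R.

(** Later periods repeat the first one, raised by the drift. *)
Lemma height_ge_period (c : int) t : 0 < n ->
  (forall k : 'I_n, (c <= height x (t + k))%R) ->
  forall s, t <= s -> (c <= height x s)%R.
Proof.
move=> n0 H s ts.
have rn : (s - t) %% n < n by rewrite ltn_mod.
have -> : s = t + Ordinal rn + (s - t) %/ n * n.
  by have := divn_eq (s - t) n => /=; lia.
rewrite heightDmul; apply: (le_trans (H (Ordinal rn))).
by rewrite lerDl mulrn_wge0.
Qed.

Lemma matchedPn i : reflect (unmatched_at x i) (i \in x :\: matched x).
Proof.
have n0 : 0 < n := leq_ltn_trans (leq0n i) (ltn_ord i).
rewrite !inE negb_and andbC; apply: (iffP idP) => [/andP[ix]|U].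
  rewrite ix /= => /existsPn nE s ts.
  suff: (height x i + 1 <= height x s)%R by lia.
  apply: (@height_ge_period _ i.+1 n0 _ s ts) => k.
  by have := nE k; rewrite addSnnS; lia.
have ix : i \in x by rewrite -pmem_ord unmatched_at_mem.
rewrite ix /=; apply/existsPn => k; rewrite -ltNge.
by apply: U; lia.
Qed.

Lemma matchedP i :
  reflect (i \in x /\ exists2 s, i < s & (height x s <= height x i)%R)
    (i \in matched x).
Proof.
apply: (iffP idP) => [|[ix [s ts H]]].
  rewrite inE => /andP[ix /existsP[k H]]; split=> //; exists (i + k.+1) => //.
  by lia.
apply: contraT => nM; have /matchedPn/(_ s ts) : i \in x :\: matched x.
  by rewrite in_setD nM.
lia.
Qed.

(** The future minimum m(t). One period suffices by [height_ge_period]; the index type ['I_n.+1]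
    supplies [ord0] even for n = 0. *)
Definition tail_min t : int :=
  height x (t + [arg min_(k < (ord0 : 'I_n.+1)) height x (t + k)]%O).

Lemma tail_min_attained t : exists2 s, t <= s & tail_min t = height x s.
Proof. by eexists; last reflexivity; rewrite leq_addr. Qed.

Lemma tail_min_le t s : 0 < n -> t <= s -> (tail_min t <= height x s)%R.
Proof.
move=> n0; apply: height_ge_period => // k.
rewrite /tail_min; case: arg_minP => // k0 _ /(_ (widen_ord (leqnSn n) k)).
exact.
Qed.

Lemma tail_min_mono s t : 0 < n -> s <= t -> (tail_min s <= tail_min t)%R.
Proof.
move=> n0 st; have [r tr ->] := tail_min_attained t.
by apply: tail_min_le => //; apply: leq_trans tr.
Qed.

(** m is constant unless i is the only time from i on at minimal height. Then i is unmatched, and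
    the height at i + 1, one higher, is the new minimum. *)
Lemma tail_minS i :
  tail_min i.+1 = (tail_min i + (i \in x :\: matched x)%:Z)%R.
Proof.
have n0 : 0 < n := leq_ltn_trans (leq0n i) (ltn_ord i).
have mono := tail_min_mono n0 (leqnSn i).
have [s is_ E] := tail_min_attained i.
have [s' is' E'] := tail_min_attained i.+1.
case: matchedPn => [U|nU].
  have Hi : tail_min i = height x i.
    apply/eqP; rewrite eq_le tail_min_le //= E.
    by move: is_; rewrite leq_eqVlt => /predU1P[<-|/U/ltW].
  have := tail_min_le n0 (leqnn i.+1); have := U _ is'.
  by rewrite -E' Hi heightS (unmatched_at_mem U); lia.
rewrite addr0; apply/eqP; rewrite eq_le mono andbT.
move: is_; rewrite leq_eqVlt => /predU1P[iE|si]; last first.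
  by rewrite E tail_min_le.
(* The minimum is attained at i itself: a matched i has a later time at most as high, and for i
   outside x the next step goes down. *)
rewrite E -iE; have [iM|iM] := boolP (i \in matched x).
  have /matchedP[_ [r ir]] := iM; apply: le_trans; exact: tail_min_le.
have ix : i \notin x.
  by apply/negP => ix; apply: nU; apply/matchedPn; rewrite in_setD iM.
have := tail_min_le n0 (leqnn i.+1).
by rewrite heightS pmem_ord (negbTE ix); lia.
Qed.

Lemma tail_min_total : 0 < n -> tail_min n = (tail_min 0 + height x n)%R.
Proof.
move=> n0; have [s ns E] := tail_min_attained n.
have [r _ E'] := tail_min_attained 0.
have := @tail_min_le n (r + n) n0 (leq_addl _ _).
have := @tail_min_le 0 (s - n) n0 (leq0n _).
have := heightDn x (s - n); rewrite subnK // heightDn; lia.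
Qed.

Lemma card_matched : #|x| + #|matched x| = n.
Proof.
have [n0|n0] := posnP n.
  have := max_card x; have := max_card (matched x); rewrite card_ord; lia.
have : (\sum_(0 <= t < n) (tail_min t.+1 - tail_min t) = height x n)%R.
  by rewrite telescope_sumr // tail_min_total //; lia.
rewrite big_mkord (eq_bigr (fun i => (i \in x :\: matched x)%:Z)%R); last first.
  by move=> i _; rewrite tail_minS; lia.
rewrite height_total.
have -> : (\sum_(i < n) (i \in x :\: matched x)%:Z = #|x :\: matched x|%:Z)%R.
  rewrite -sum1_card -[RHS]natz natr_sum [RHS]big_mkcond /=.
  by apply: eq_bigr => i _; case: (i \in _).
have := cardsID (matched x) x; rewrite (setIidPr (matched_sub x)); lia.
Qed.

(** An unmatched member turns from an up step into a down step, a loss of 2, exactly where m rises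
    by 1. *)
Lemma height_matched t : t <= n ->
  height (matched x) t = (height x t - 2%:Z * (tail_min t - tail_min 0))%R.
Proof.
elim: t => [|t IH] tn; first by rewrite !height0 subrr mulr0 subr0.
have pE z : pmem z t = (Ordinal tn \in z) := pmem_ord z (Ordinal tn).
rewrite !heightS IH 1?ltnW // (tail_minS (Ordinal tn)) !pE in_setD /=.
have /implyP := subsetP (matched_sub x) (Ordinal tn).
by case: (_ \in x); case: (_ \in matched x) => //= _; lia.
Qed.

End NonnegDrift.

(** * Signatures read off the walk, and the identification of p(x) *)

(* The steps are of size 1, so a return to height at most [height x i] after
   time [i] passes through [height x i] itself. *)
Lemma sg_mem x i : i \in x ->
  sg x i = if [exists k : 'I_n.+1, (i < k) && (height x k <= height x i)%R]
           then Some true else None.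
Proof.
move=> ix; rewrite ffunE ix; congr (if _ then _ else _).
apply/existsP/existsP => [[j /andP[ij /eqP c0]]|[k /andP[ik Hk]]].
  have jn : j.+1 < n.+1 := ltn_ord j.
  exists (Ordinal jn); move: c0; rewrite /= cdiff_height ?(ltnW ij) //.
  by lia.
have exk : exists t, (i < t <= n) && (height x t <= height x i)%R.
  by exists k; rewrite ik Hk -ltnS ltn_ord.
case: (ex_minnP exk) => m /andP[/andP[im mn] Hm] min_m.
case: m im mn Hm min_m => // m; rewrite ltnS => im mn Hm min_m.
have Hi := heightS x i; rewrite pmem_ord ix in Hi.
have im' : i < m by rewrite ltn_neqAle im andbT; apply: contraTneq Hm => <-; lia.
exists (Ordinal mn); rewrite /= im' cdiff_height ?(ltnW im') //=.
have := min_m m; rewrite im' ltnn (ltnW mn) /= => /contraFN/(_ erefl).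
by move: Hm; rewrite heightS; case: ifP => _; lia.
Qed.

(** Mirror image of [sg_mem]: the last suitable earlier time replaces the first later one. *)
Lemma sg_notin x i : i \notin x ->
  sg x i = if [exists k : 'I_n.+1, (k <= i) && (height x k <= height x i.+1)%R]
           then Some false else None.
Proof.
move=> ix; rewrite ffunE (negbTE ix); congr (if _ then _ else _).
apply/existsP/existsP => [[j /andP[ji /eqP c0]]|[k /andP[ki Hk]]].
  exists (widen_ord (leqnSn n) j); move: c0; rewrite /= cdiff_height ?(ltnW ji) //.
  by lia.
have exk : exists t, (t <= i) && (height x t <= height x i.+1)%R.
  by exists k; rewrite ki Hk.
have bnd t : (t <= i) && (height x t <= height x i.+1)%R -> t <= i by case/andP.
case: (ex_maxnP exk bnd) => m /andP[mi Hm] max_m.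
have Hi := heightS x i; rewrite pmem_ord (negbTE ix) in Hi.
have mi' : m < i by rewrite ltn_neqAle mi andbT; apply: contraTneq Hm => ->; lia.
have mn : m < n := ltn_trans mi' (ltn_ord i).
exists (Ordinal mn); rewrite /= mi' cdiff_height //=.
have := max_m m.+1; rewrite mi' ltnn /= => /contraFN/(_ erefl).
by move: Hm; rewrite (heightS x m); case: ifP => _; lia.
Qed.

(** If j were not in x, compare the heights at i and j + 1: depending on which is smaller, i gets
    the symbol 1 or j the symbol 0. *)
Lemma sg_stars_sorted x i j :
  sg x i = None -> sg x j = None -> i < j -> i \in x -> j \in x.
Proof.
move=> si sj ij ix; apply: contraT => jx.
have jn : j.+1 < n.+1 := ltn_ord j.
move: si; rewrite (sg_mem ix).
case: existsP => // nE _; move: sj; rewrite (sg_notin jx).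
case: existsP => // nE' _.
case: (lerP (height x j.+1) (height x i)) => [H|/ltW H].
  by case: nE; exists (Ordinal jn); rewrite /= H ltnW.
case: nE'; exists (widen_ord (leqnSn n) i).
by rewrite /= H ltnW.
Qed.

Lemma sg_nostar_mem x y i : sg x = sg y -> sg x i != None -> (i \in x) = (i \in y).
Proof.
move=> xy; have := congr1 (fun f : {ffun _} => f i) xy.
have [ix|ix] := boolP (i \in x); have [iy|iy] := boolP (i \in y) => //;
  rewrite ?(sg_mem ix) ?(sg_mem iy) ?(sg_notin ix) ?(sg_notin iy);
  by do 2!case: ifP => _.
Qed.

(** Off the stars the symbols fix membership, and among the stars the members come last, so the size
    determines the set. *)
Lemma sg_card_inj x y : sg x = sg y -> #|x| = #|y| -> x = y.
Proof.
move=> xy card_xy; apply/eqP; rewrite eqEcard card_xy leqnn andbT.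
apply: contraT => /subsetPn[i ix iy].
have /subsetPn[j jy jx] : ~~ (y \subset x).
  apply: contra iy => yx; suff -> : y = x by [].
  by apply/eqP; rewrite eqEcard yx card_xy leqnn.
have star k : (k \in x) != (k \in y) -> sg x k = None.
  by move=> kxy; apply/eqP; apply: contraNT kxy => /(sg_nostar_mem xy)->.
have si : sg x i = None by apply: star; rewrite ix (negbTE iy).
have sj : sg x j = None by apply: star; rewrite jy (negbTE jx).
have [ij|ji|/val_inj ij] := ltngtP i j; last by rewrite -ij ix in jx.
  by rewrite (sg_stars_sorted si sj) in jx.
by rewrite (sg_stars_sorted (x := y) (i := j)) -?xy in iy.
Qed.

(** Each position is tested on the walk h - 2(m - m(0)) of [matched x]. As m is nondecreasing, one
    direction is immediate in each of the first two cases; the other needs a stretch on which m is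
    constant. *)
Lemma sg_matched x : (0 <= height x n)%R -> sg (matched x) = sg x.
Proof.
move=> drift; apply/ffunP => i.
have n0 : 0 < n := leq_ltn_trans (leq0n i) (ltn_ord i).
have mono s t : s <= t -> (tail_min x s <= tail_min x t)%R.
  exact: tail_min_mono.
have le s t : s <= t -> (tail_min x s <= height x t)%R.
  exact: tail_min_le.
have Hy (k : 'I_n.+1) := height_matched drift (leq_ord k : k <= n).
have Hyi := height_matched drift (ltnW (ltn_ord i)).
have HyS := height_matched drift (ltn_ord i).
have mS := tail_minS drift i.
have [iM|iM] := boolP (i \in matched x).
  have [ix [s is_ Hs]] := matchedP drift i iM.
  rewrite in_setD iM /= addr0 in mS.
  rewrite (sg_mem ix) (sg_mem iM); congr (if _ then _ else _).
  apply/existsP/existsP => [[k /andP[ik Hk]]|[k /andP[ik Hk]]]; last first.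
    exists k; rewrite ik /=; have := mono _ _ (ltnW ik).
    by rewrite Hy Hyi; lia.
  (* If x returns only after time n, then m takes the same value at i and n, so both walks have the
     same increments on [i, n] and the return at k is one for x too. *)
  apply/existsP; apply: contraT => /existsPn nE.
  have gt t : i < t <= n -> (height x i < height x t)%R.
    move=> /andP[it tn]; have := nE (Ordinal (tn : t < n.+1)).
    by rewrite /= it /= ltNge.
  have ns : n < s by rewrite ltnNge; apply/negP => sn; have := gt s; lia.
  have tn : (tail_min x n <= tail_min x i)%R.
    have [r ir ->] := tail_min_attained x i.
    have [rn|rn] := leqP r n; last exact/le/ltnW.
    have /le_trans-> // := le n s (ltnW ns); apply: (le_trans Hs).
    by move: ir; rewrite leq_eqVlt => /predU1P[<-//|ir]; rewrite ltW ?gt ?ir.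
  have := gt k; rewrite ik -ltnS ltn_ord => /(_ isT).
  have := mono _ _ (ltnW ik); have := mono _ _ (leq_ord k : k <= n).
  by rewrite Hy Hyi in Hk; lia.
have [ix|ix] := boolP (i \in x); last first.
  rewrite in_setD (negbTE ix) andbF addr0 in mS.
  rewrite (sg_notin ix) (sg_notin iM); congr (if _ then _ else _).
  apply/existsP/existsP => [[k /andP[ki Hk]]|[k /andP[ki Hk]]].
    exists k; rewrite ki /=; have := mono _ _ ki.
    by rewrite Hy HyS in Hk; lia.
  (* Take the last such time m. The walk of x stays above height x i.+1 between m and i + 1, so the
     future minimum from m equals that from i + 1, and m is a witness for [matched x] as well. *)
  have exk : exists t, (t <= i) && (height x t <= height x i.+1)%R.
    by exists k; rewrite ki Hk.
  have bnd t : (t <= i) && (height x t <= height x i.+1)%R -> t <= i by case/andP.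
  case: (ex_maxnP exk bnd) => m /andP[mi Hm] max_m.
  have Hi := heightS x i; rewrite pmem_ord (negbTE ix) in Hi.
  have mn : m < n.+1 by have := ltn_ord i; lia.
  exists (Ordinal mn); rewrite /= mi /=.
  suff tm : (tail_min x i <= tail_min x m)%R.
    by have := Hy (Ordinal mn); rewrite /= => ->; rewrite HyS; lia.
  have gt t : m < t <= i -> (height x i.+1 < height x t)%R.
    by move=> /andP[mt ti]; rewrite ltNge; apply/negP => Ht; have := max_m t; rewrite ti Ht; lia.
  have Hmi : height x m = height x i.+1.
    have m_i : m < i by rewrite ltn_neqAle mi andbT; apply: contraTneq Hm => ->; lia.
    by have := gt m.+1; rewrite ltnSn m_i (heightS x m) => /(_ isT); case: ifP => _; lia.
  have [r mr ->] := tail_min_attained x m; rewrite -mS.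
  have [ri|/le//] := leqP r i; apply: (le_trans (le i.+1 i.+1 (leqnn _))).
  move: mr; rewrite leq_eqVlt => /predU1P[<-|mr]; first by rewrite Hmi.
  by rewrite ltW // gt ?mr.
(* An unmatched i is a star in both. Up to a constant, the walk of [matched x] is h - 2m >= -m,
   hence at least -m(i) up to time i, and it equals -m(i) - 1 at i + 1. *)
have U : unmatched_at x i by apply/(matchedPn drift); rewrite in_setD iM.
rewrite (sg_mem ix) (sg_notin iM); case: existsP => [[k /andP[ki Hk]]|_]; last first.
  by case: existsP => // -[k /andP[ik]]; have := U k ik; lia.
have tm : (height x i <= tail_min x i)%R.
  have [r ir ->] := tail_min_attained x i.
  by move: ir; rewrite leq_eqVlt => /predU1P[<-//|/U/ltW].
have HS := heightS x i; rewrite pmem_ord ix in HS.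
rewrite in_setD iM ix in mS; have := mono _ _ ki; have := le k k (leqnn _).
by rewrite Hy HyS in Hk; lia.
Qed.

(** By [sg_card_inj] at most one set has the given signature and size, so [pick] can only return
    [matched x]. *)
Lemma partnerE x : n <= #|x|.*2 -> partner x = matched x.
Proof.
move=> nx; have drift : (0 <= height x n)%R by rewrite height_total; lia.
have cM := card_matched drift; rewrite /partner.
case: pickP => [y /andP[/eqP sy /eqP cy]|/(_ (matched x))] /=; last first.
  by rewrite sg_matched // cM !eqxx.
apply: sg_card_inj; first by rewrite sy sg_matched.
by apply/eqP; rewrite -(eqn_add2l #|x|) cy cM.
Qed.

(** * Deleting and inserting unmatched members *)

(** A smaller set has smaller increments, so a return of the walk persists. *)
Lemma matched_anti x y i : (0 <= height x n)%R -> (0 <= height y n)%R ->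
  y \subset x -> i \in matched x -> i \in y -> i \in matched y.
Proof.
move=> dx dy yx /(matchedP dx)[_ [s is_ Hs]] iy; apply/(matchedP dy).
split=> //; exists s => //; have := height_mono yx (ltnW is_); lia.
Qed.

Lemma ex_last_min x t : (0 < height x n)%R ->
  exists u, [/\ t <= u < t + n, unmatched_at x u &
                forall s, t <= s -> (height x u <= height x s)%R].
Proof.
move=> d0; have drift := ltW d0.
have n0 : 0 < n.
  by rewrite lt0n; apply: contraTneq d0 => /(congr1 (height x))->; rewrite height0.
pose P u := (t <= u) && (height x u == tail_min x t).
have exP : exists u, P u.
  by have [s ts E] := tail_min_attained x t; exists s; rewrite /P ts E eqxx.
(* A minimum at a time u >= t + n would be undercut at u - n, since the drift is positive. *)
have bnd u : P u -> u <= t + n.-1.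
  case/andP=> tu /eqP E; rewrite leqNgt; apply/negP => H.
  have := tail_min_le drift n0 (_ : t <= u - n) ; rewrite -E.
  have := heightDn x (u - n); rewrite subnK; last by lia.
  by move=> -> /(_ ltac:(lia)); lia.
case: (ex_maxnP exP bnd) => u /andP[tu /eqP E] max_u.
exists u; split=> [|s us|s ts]; last by rewrite E tail_min_le.
  by have := bnd u; rewrite /P tu E eqxx => /(_ isT); lia.
have ts : t <= s := leq_trans tu (ltnW us).
rewrite lt_neqAle E tail_min_le // andbT; apply: contraTneq us => Es.
by rewrite -leqNgt max_u // /P ts Es eqxx.
Qed.

Lemma modn_neq_period s t : s < t < s + n -> s %% n != t %% n.
Proof.
move=> /andP[st tn]; rewrite eq_sym eqn_mod_dvd ?(ltnW st) //.
by rewrite gtnNdvd ?subn_gt0 // ltn_subLR // ltnW.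
Qed.

(* With [y] the common set [x1 :\ i1 = x2 :\ i2] and [u1 < u2], the heights of
   [x1] and [x2] have the same increments strictly between [u1] and [u2].
   Minimality of [u2] makes the increment of [x2] from [u1.+1] to [u2]
   nonpositive, so [x1], which loses one more unit at [u2], is back at its
   height at [u1], although [u1] is unmatched. *)
Lemma delete_last_min_inj x1 x2 i1 i2 t u1 u2 :
    i1 = u1 %% n :> nat -> i2 = u2 %% n :> nat ->
    t <= u1 < t + n -> t <= u2 < t + n ->
    unmatched_at x1 u1 -> unmatched_at x2 u2 ->
    (forall s, t <= s -> (height x1 u1 <= height x1 s)%R) ->
    (forall s, t <= s -> (height x2 u2 <= height x2 s)%R) ->
  x1 :\ i1 = x2 :\ i2 -> x1 = x2.
Proof.
wlog: x1 x2 i1 i2 u1 u2 / u1 <= u2 => [hw|].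
  have [u12|/ltnW u21] := leqP u1 u2; first exact: hw.
  by move=> *; symmetry; apply: (hw x2 x1 i2 i1 u2 u1).
rewrite leq_eqVlt => /predU1P[<-|u12] E1 E2 /andP[tu1 u1n] /andP[tu2 u2n] U1 U2 min1 min2 eq12.
  have i12 : i1 = i2 by apply: val_inj; rewrite /= E1 E2.
  have /setD1K <- : i1 \in x1 by rewrite -pmem_ord E1 pmem_mod unmatched_at_mem.
  have /setD1K <- : i2 \in x2 by rewrite -pmem_ord E2 pmem_mod unmatched_at_mem.
  by rewrite eq12 i12.
have pE s : pmem x1 s && (i1 != s %% n :> nat) = pmem x2 s && (i2 != s %% n :> nat).
  by rewrite -!pmemD1 eq12.
have ag : (height x1 u2 - height x1 u1.+1 = height x2 u2 - height x2 u1.+1)%R.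
  apply: height_agree => // s /andP[u1s su2]; have := pE s.
  rewrite E1 E2 modn_neq_period; last by lia.
  by rewrite eq_sym modn_neq_period ?andbT //; lia.
have p2 : pmem x1 u2 = false.
  have := pE u2; rewrite E1 E2 eqxx andbF modn_neq_period ?andbT //; lia.
have := U1 u2.+1 (leqW u12); have := min2 u1.+1 (leqW tu1).
by rewrite !heightS p2 (unmatched_at_mem U1) in ag *; lia.
Qed.

Lemma ex_unmatched_insert x y :
    (0 <= height x n)%R -> (0 <= height y n)%R ->
    x \proper y -> matched y \subset x ->
  exists2 u, u \in y :\: x & unmatched_at (u |: x) u.
Proof.
move=> dx dy /andP[xy /subsetPn[i0 i0y i0x]] Myx.
have i0P : i0 \in y :\: x by rewrite inE i0x.
have n0 : 0 < n := leq_ltn_trans (leq0n i0) (ltn_ord i0).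
(* [u] is chosen in [y :\: x] where the walk of x is lowest. *)
case: (@arg_minP _ _ _ i0 (mem (y :\: x)) (fun i => height x i) i0P) => u uP min_u.
exists u => //; have /setDP[uy ux] := uP.
have dz : (0 <= height (u |: x) n)%R.
  by have := height_mono (subsetUr [set u] x) (leq0n n); rewrite !height0; lia.
apply/(matchedPn dz); rewrite !inE eqxx /= andbT; apply/existsPn => k.
(* A return of [u |: x] at j puts the walk of x at j at least 2 below its height at u. *)
rewrite -ltNge ltNge; apply/negP => Hk; set j := u + k.+1 in Hk.
have ag : (height (u |: x) j - height (u |: x) u.+1 = height x j - height x u.+1)%R.
  apply: height_agree => [|s /andP[us sj]]; first by rewrite /j; lia.
  rewrite pmemU1 -{1}(modn_small (ltn_ord u)) (negbTE (modn_neq_period _)) ?orbF //.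
  by rewrite /j in sj; have := ltn_ord k; lia.
rewrite !heightS !pmem_ord (negbTE ux) !inE eqxx /= in ag.
(* Let v be the last time before j at which y and x differ. It is unmatched in y because [matched y]
   lies in x, so the walk of x at j is at most 1 below its height at v, which by the choice of u and
   the drift is at least that at u: a contradiction. *)
have exP : exists s, (u <= s < j) && (pmem y s && ~~ pmem x s).
  by exists u; rewrite !pmem_ord uy ux /j; lia.
have bnd s : (u <= s < j) && (pmem y s && ~~ pmem x s) -> s <= j.
  by case/andP=> /andP[_ /ltnW].
case: (ex_maxnP exP bnd) => v /andP[/andP[uv vj] /andP[vy vx]] max_v.
have rn : v %% n < n by rewrite ltn_mod.
pose r := Ordinal rn.
have rP : r \in y :\: x by rewrite inE -!pmem_ord /= !pmem_mod vy vx.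
have Uv : unmatched_at y v.
  apply/unmatched_at_mod; apply/(matchedPn dy r); move: rP; rewrite !in_setD => /andP[rx ->].
  by rewrite andbT; apply: contra rx; apply: (subsetP Myx).
have ag' : (height y j - height y v.+1 = height x j - height x v.+1)%R.
  apply: height_agree => // s /andP[vs sj].
  apply/idP/idP => [ys|]; last exact: pmem_sub.
  by apply: contraLR (vs) => xs; rewrite -leqNgt max_v // ys xs sj (leq_trans uv) // ltnW.
rewrite !heightS vy (negbTE vx) in ag'.
have := min_u r rP; have := Uv j vj; rewrite (height_mod x v) in ag'.
have := mulrn_wge0 (v %/ n) dx.
by move: ag ag' Hk; rewrite /=; clear; lia.
Qed.

Lemma matched_delete x i : (0 <= height x n)%R -> (0 <= height (x :\ i) n)%R ->
  i \notin matched x -> matched x \subset matched (x :\ i).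
Proof.
move=> dx dy iM; apply/subsetP => j jM; apply: (matched_anti dx) => //.
  exact: subD1set.
rewrite !inE (subsetP (matched_sub x)) // andbT.
by apply: contraTneq jM => ->.
Qed.

End Height.

(** * Symmetry and composition of normalized matching graphs *)

Section NormalizedMatching.
Variables (T : finType) (E : rel T).
Implicit Types A B C X : {set T}.

Lemma normalized_matchingP A B : A != set0 -> B != set0 ->
  (forall X, X \subset A -> #|X| * #|B| <= #|nbhd E B X| * #|A|) <->
  normalized_matching_graph E A B.
Proof.
rewrite -!card_gt0 => A0 B0; split=> H X /H.
  by rewrite ler_pdivrMr ?ltr0n // mulrAC ler_pdivlMr ?ltr0n // -!natrM ler_nat.
by rewrite ler_pdivrMr ?ltr0n // mulrAC ler_pdivlMr ?ltr0n // -!natrM ler_nat.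
Qed.

(** Apply the hypothesis to the members of A with no neighbour in Y: their neighbourhood avoids
    Y. *)
Lemma normalized_matching_sym A B : symmetric E -> A != set0 -> B != set0 ->
  normalized_matching_graph E A B -> normalized_matching_graph E B A.
Proof.
move=> symE A0 B0 /(normalized_matchingP A0 B0) H.
apply/normalized_matchingP => // Y YB.
have /H : A :\: nbhd E A Y \subset A by apply: subsetDl.
have nY : nbhd E B (A :\: nbhd E A Y) \subset B :\: Y.
  apply/subsetP => b; rewrite !inE => /andP[bB /exists_inP[a]].
  rewrite !inE bB andbT => /andP[aN aA] ab; apply: contra aN => bY.
  by rewrite aA; apply/exists_inP; exists b; rewrite // symE.
have /subset_leq_card := nY; rewrite !cardsD (setIidPr YB) (setIidPr _); last first.
  by apply/subsetP => a; rewrite inE => /andP[].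
have : #|nbhd E A Y| <= #|A|.
  by apply/subset_leq_card/subsetP => a; rewrite inE => /andP[].
have /subset_leq_card := YB.
move: #|nbhd E B _| #|nbhd E A Y| #|A| #|B| #|Y| => m p a b y yb pa mb; nia.
Qed.

(** Neighbours of neighbours are neighbours. Transitivity is asked only along A, B, C, since
    comparability is not transitive. *)
Lemma normalized_matching_trans A B C : A != set0 -> B != set0 -> C != set0 ->
    (forall a b c, a \in A -> b \in B -> c \in C -> E a b -> E b c -> E a c) ->
  normalized_matching_graph E A B -> normalized_matching_graph E B C ->
  normalized_matching_graph E A C.
Proof.
move=> A0 B0 C0 trE AB BC X XA.
have sB : nbhd E B X \subset B by apply/subsetP => b; rewrite inE => /andP[].
apply: le_trans (AB X XA) _; apply: le_trans (BC _ sB) _.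
rewrite ler_wpM2r ?invr_ge0 ?ler0n // ler_nat; apply/subset_leq_card/subsetP => c.
rewrite !inE => /andP[cC /exists_inP[b]]; rewrite inE => /andP[bB /exists_inP[a aX ab]] bc.
by rewrite cC; apply/exists_inP; exists a; rewrite // (trE a b c) // (subsetP XA).
Qed.

End NormalizedMatching.

(** Choosing images turns [R] into an injection; a relation fits because the deleted element is only
    known to exist. *)
Lemma leq_card_inj_rel (T : finType) (U : finType) (R : T -> U -> Prop)
    (A : {set T}) (B : {set U}) :
  (forall x, x \in A -> exists2 y, y \in B & R x y) ->
  (forall x x' y, x \in A -> x' \in A -> R x y -> R x' y -> x = x') ->
  #|A| <= #|B|.
Proof.
move=> exR injR; have [->|[a0 a0A]] := set_0Vmem A; first by rewrite cards0.
have [b0 _ _] := exR _ a0A.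
have /fin_all_exists[f Hf] : forall x, exists y, x \in A -> y \in B /\ R x y.
  move=> x; have [/exR[y yB Ry]|] := boolP (x \in A); first by exists y.
  by exists b0.
have injf : {in A &, injective f}.
  move=> x x' xA x'A fE; apply: (injR _ _ (f x)) => //; first exact: (Hf x xA).2.
  by rewrite fE; exact: (Hf x' x'A).2.
rewrite -(card_in_imset injf); apply/subset_leq_card/subsetP => _ /imsetP[x xA ->].
exact: (Hf x xA).1.
Qed.

(** * The levels of Q and the matching of adjacent levels *)

Section Layers.
Variable n : nat.
Implicit Types (x y : Q n) (k : nat).

Lemma drift_ge0 x : (0 <= height (val x) n)%R.
Proof. by rewrite height_total; have := valP x; lia. Qed.

Lemma lt_matched y x : (y < x)%O =
  [&& y != x, matched (val x) \subset matched (val y) & val y \subset val x].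
Proof.
rewrite [LHS]/(Qlt y x) /Qlt !partnerE ?(valP x) ?(valP y) //.
by rewrite matched_sub.
Qed.

Lemma lt_card y x : (y < x)%O -> #|val y| < #|val x|.
Proof.
rewrite lt_matched => /and3P[yx _ s]; apply: proper_card.
by rewrite properEneq s andbT -(inj_eq val_inj) in yx *.
Qed.

Lemma lt_delete y x (i : 'I_n) :
  val y = val x :\ i -> unmatched_at (val x) i -> (y < x)%O.
Proof.
move=> yE U; have ix : i \in val x by rewrite -pmem_ord unmatched_at_mem.
have dy := drift_ge0 y; rewrite yE in dy.
have iM : i \notin matched (val x).
  by have /(matchedPn (drift_ge0 x)) := U; rewrite in_setD => /andP[].
rewrite lt_matched yE matched_delete ?drift_ge0 // subD1set !andbT.
by apply: contraTneq ix => <-; rewrite yE !inE eqxx.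
Qed.

Lemma ex_delete x k (i : 'I_n) : n <= k.*2 -> #|val x| = k.+1 -> i \in val x ->
  exists2 y : Q n, y \in layer n k & val y = val x :\ i.
Proof.
move=> nk cx ix; have cy : #|val x :\ i| = k.
  by move: cx; rewrite (cardsD1 i) ix => -[].
have yQ : n <= #|val x :\ i|.*2 by rewrite cy.
by exists (Sub (val x :\ i) yQ : Q n); rewrite ?inE SubK ?cy.
Qed.

Lemma card_layer k : n <= k.*2 -> #|layer n k| = 'C(n, k).
Proof.
move=> nk; rewrite -[in RHS](card_ord n) -card_draws.
rewrite -(card_imset _ (val_inj : injective (val : Q n -> _))).
apply: eq_card => A; rewrite !inE; apply/imsetP/idP => [[x]|/eqP cA].
  by rewrite inE => cx ->.
have AQ : n <= #|A|.*2 by rewrite cA.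
by exists (Sub A AQ : Q n); rewrite ?inE SubK ?cA.
Qed.

Lemma layer_neq0 k : uphalf n <= k <= n -> layer n k != set0.
Proof.
move=> /andP[nk kn]; rewrite -card_gt0 card_layer ?bin_gt0 //.
by rewrite -leq_uphalf_double.
Qed.

(** The deletion map for one fixed z; its injectivity is [delete_last_min_inj]. *)
Lemma card_fiber k (X : {set Q n}) (z : 'I_n) : n <= k.*2 -> X \subset layer n k.+1 ->
  #|[set x in X | z \notin matched (val x)]| <=
  #|[set y in nbhd (fun x y : Q n => (x >=< y)%O) (layer n k) X | z \notin val y]|.
Proof.
move=> nk /subsetP Xk.
have cX x : x \in X -> #|val x| = k.+1 by move=> /Xk; rewrite inE => /eqP.
pose R x y := exists u (i : 'I_n), [/\ i = u %% n :> nat, z <= u < z + n,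
  unmatched_at (val x) u, (forall s, z <= s -> (height (val x) u <= height (val x) s)%R)
  & val y = val x :\ i].
apply: (@leq_card_inj_rel _ _ R) => [x|x x' y _ _]; last first.
  move=> [u [i [E zu U min_u yE]]] [u' [i' [E' zu' U' min_u' yE']]].
  apply/val_inj/(delete_last_min_inj E E' zu zu') => //.
  by rewrite -yE -yE'.
rewrite inE => /andP[xX zM]; have cx := cX x xX.
have d0 : (0 < height (val x) n)%R by rewrite height_total cx; lia.
have [u [zu U min_u]] := ex_last_min z d0.
have un : u %% n < n by rewrite ltn_mod; have := ltn_ord z; lia.
pose i := Ordinal un.
have Ui : unmatched_at (val x) i by apply/unmatched_at_mod.
have ix : i \in val x by rewrite -pmem_ord unmatched_at_mem.
have [y yk yE] := ex_delete nk cx ix.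
exists y; last by exists u, i.
rewrite inE [y \in nbhd _ _ _]inE yk andTb; apply/andP; split.
  apply/exists_inP; exists x => //; apply: ge_comparable; apply: ltW.
  exact: lt_delete yE Ui.
(* If z is in x, it is unmatched, hence strictly below all later times; so the minimum u is z
   itself, which is deleted. *)
rewrite yE !inE negb_and negbK; have [zx|] := boolP (z \in val x); last by rewrite orbT.
have Uz : unmatched_at (val x) z.
  by apply/(matchedPn (drift_ge0 x)); rewrite in_setD zM.
have zuE : u = z.
  case/andP: zu; rewrite leq_eqVlt => /predU1P[//|/Uz].
  by have := min_u z (leqnn z); rewrite leNgt => /negPf->.
by rewrite orbF; apply/eqP/val_inj; rewrite /= zuE modn_small.
Qed.

(** Counts the pairs of x in X and z outside f x in two ways. *)
Lemma sum_card_notin (X : {set Q n}) (f : Q n -> {set 'I_n}) m :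
  (forall x, x \in X -> #|f x| = m) -> m <= n ->
  \sum_(z < n) #|[set x in X | z \notin f x]| = #|X| * (n - m).
Proof.
move=> fm mn.
transitivity (\sum_(z < n) \sum_(x in X) (z \notin f x)).
  apply: eq_bigr => z _; rewrite -sum1_card big_mkcond [RHS]big_mkcond /=.
  by apply: eq_bigr => x _; rewrite !inE; case: (x \in X); case: (z \in f x).
rewrite exchange_big /= -sum_nat_const; apply: eq_bigr => x xX.
have := cardsC (f x); rewrite card_ord fm // => /(canRL (addKn _)) <-.
by rewrite -sum1_card [RHS]big_mkcond; apply: eq_bigr => z _; rewrite inE; case: (z \in f x).
Qed.

Lemma normalized_matching_down k : uphalf n <= k < n ->
  normalized_matching_graph (fun x y : Q n => (x >=< y)%O) (layer n k.+1) (layer n k).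
Proof.
move=> /andP[nk kn]; have nk2 : n <= k.*2 by rewrite -leq_uphalf_double.
apply/normalized_matchingP; rewrite ?layer_neq0 ?nk ?(ltnW kn) ?(leqW nk) //.
move=> X Xk; set Y := nbhd _ _ _.
have Xc x : x \in X -> #|matched (val x)| = n - k.+1.
  move=> /(subsetP Xk); rewrite inE => /eqP cx.
  by have := card_matched (drift_ge0 x); rewrite cx; lia.
have Yc y : y \in Y -> #|val y| = k by rewrite !inE => /andP[/eqP].
have : \sum_(z < n) #|[set x in X | z \notin matched (val x)]| <=
       \sum_(z < n) #|[set y in Y | z \notin val y]|.
  by apply: leq_sum => z _; apply: card_fiber.
rewrite (sum_card_notin Xc) ?(sum_card_notin Yc) ?leq_subr ?(ltnW kn) // subKn //.
rewrite !card_layer //; last by lia.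
(* The inequality |X| C(n,k) <= |Y| C(n,k+1) follows after cancelling the positive factor n - k. *)
have := mul_bin_left n k; have : 0 < n - k by rewrite subn_gt0.
move: ('C(n, k)) ('C(n, k.+1)) (n - k) #|X| #|Y| => a b m p q m0 ba pq.
nia.
Qed.

End Layers.

(** * The grading of Q and the passage to arbitrary pairs of levels *)

Theorem theorem2p2 (n : nat) :
  graded (uphalf n) n (layer n) /\
  normalized_matching_poset (uphalf n) n (layer n).
Proof.
suff [G N] : graded (uphalf n) n (layer n) /\
  forall i j, uphalf n <= i <= n -> uphalf n <= j <= n -> i != j ->
  normalized_matching_graph (fun x y : Q n => (x >=< y)%O) (layer n i) (layer n j).
  by split.
split.
  split.
  - by move=> i; apply: layer_neq0.
  - move=> x; exists #|val x|; split; last by move=> j [_]; rewrite inE => /eqP.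
    rewrite inE eqxx; split=> //; have := max_card (val x).
    by rewrite card_ord => ->; rewrite leq_uphalf_double (valP x).
  - move=> x; rewrite inE; split=> [/eqP cx y|min_x].
      apply/negP => /lt_card; rewrite cx ltnNge leq_uphalf_double.
      by rewrite (valP y).
    (* Above the lowest level the drift is positive, so an unmatched member exists, and deleting it
       contradicts minimality. *)
    have : uphalf n <= #|val x| by rewrite leq_uphalf_double (valP x).
    rewrite leq_eqVlt eq_sym => /predU1P[->//|cx].
    have nx : n.+1 < #|val x|.*2 by rewrite -ltn_uphalf_double.
    have d0 : (0 < height (val x) n)%R by rewrite height_total; lia.
    have [u [_ U _]] := ex_last_min 0 d0.
    have n0 : 0 < n.
      by have := max_card (val x); rewrite card_ord; apply: leq_trans; apply: leq_ltn_trans cx.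
    have un : u %% n < n by rewrite ltn_mod.
    have Ui : unmatched_at (val x) (Ordinal un) by apply/unmatched_at_mod.
    have ix : Ordinal un \in val x by rewrite -pmem_ord unmatched_at_mem.
    have [||y _ yE] := @ex_delete n x #|val x|.-1 _ _ _ ix; [lia|lia|].
    by have := min_x y; rewrite (lt_delete yE Ui).
  - move=> x y i j _ _; rewrite !inE => /eqP cx /eqP cy [xy cov].
    have := xy; rewrite lt_matched => /and3P[nxy Mxy sxy].
    have pxy : val x \proper val y by rewrite properEneq sxy andbT (inj_eq val_inj).
    have Myx := subset_trans Mxy (matched_sub _).
    have [u /setDP[uy ux] U] := ex_unmatched_insert (drift_ge0 x) (drift_ge0 y) pxy Myx.
    have cz : #|u |: val x| = i.+1 by rewrite cardsU1 ux cx.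
    have zQ : n <= #|u |: val x|.*2.
      by rewrite cz -cx (leq_trans (valP x)) // leq_double.
    pose z : Q n := Sub (u |: val x) zQ.
    have xz : (x < z)%O.
      by apply: (@lt_delete _ _ _ u); rewrite SubK // setU1K.
    have zy : val z \subset val y by rewrite SubK subUset sub1set uy.
    suff zE : z = y by rewrite -cy -zE SubK cz.
    (* Otherwise x < z < y, against the cover: [matched y] lies in x, hence in z, and stays matched
       there. *)
    apply/eqP; have := cov z; rewrite xz /= lt_matched zy andbT; apply: contraNT => ->.
    apply/subsetP => v vM; have vx := subsetP Myx v vM.
    apply: (matched_anti (drift_ge0 y) (drift_ge0 z) zy vM).
    by rewrite SubK in_setU1 vx orbT.
have symE : symmetric (fun x y : Q n => (x >=< y)%O) by move=> x y; apply: comparable_sym.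
(* Induction on the upper level, one adjacent pair at a time. *)
have down i j : uphalf n <= i < j -> j <= n ->
    normalized_matching_graph (fun x y : Q n => (x >=< y)%O) (layer n j) (layer n i).
  move=> /andP[ni]; elim: j => // j IH; rewrite ltnS leq_eqVlt => /predU1P[<-|ij] jn.
    exact/normalized_matching_down/andP.
  have nj := leq_trans ni (ltnW ij).
  apply: (@normalized_matching_trans _ _ _ (layer n j)); rewrite ?layer_neq0 //; try lia.
  - move=> a b c; rewrite !inE => /eqP ca /eqP cb /eqP cc ab bc.
    (* Comparable elements of different sizes are ordered by size, so relations going down the
       levels compose. *)
    have lt (x y : Q n) : #|val y| < #|val x| -> (x >=< y)%O -> (y < x)%O.
      by move=> cxy; case: comparableP cxy => // [/lt_card|->]; rewrite ?ltnn //; lia.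
    apply: ge_comparable; apply: le_trans (ltW (lt _ _ _ bc)) (ltW (lt _ _ _ ab)); lia.
  - by apply: normalized_matching_down; rewrite nj.
  - by apply: IH => //; exact: ltnW.
move=> i j ni nj; rewrite neq_ltn => /orP[ij|ji]; last by apply: down; lia.
by apply: normalized_matching_sym; rewrite ?layer_neq0 //; apply: down; lia.
Qed.
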